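(* Let $\Xi$ be any scale limit and $f$ be any scaling function. Then there exists a sequence of permutations which converges at scale $f$ to $\Xi$.
   Context: A scaling function is a function $f:\mathbb{N}\to\mathbb{R}^+$ with $f(n)\le n$ for all $n$, $f(n)\to\infty$ and $f(n)/n\to 0$. Let $S_n$ be the set of permutations of $[n]=\{1,\dots,n\}$ and $S=\bigcup_n S_n$. An occurrence of a pattern $\pi\in S_k$ in $\sigma\in S_n$ is a $k$-element set of indices $i_1<\dots<i_k$ such that $\sigma(i_1)\dots\sigma(i_k)$ is order-isomorphic to $\pi$; its width is $i_k-i_1+1$. For real $f\in[k,n]$, $\rho_f(\pi,\sigma)$ is the number of occurrences of $\pi$ in $\sigma$ of width at most $f$ divided by the number of $k$-element subsets of $[n]$ of width at most $f$. A sequence $(\sigma_j)$ with $|\sigma_j|\to\infty$ converges at scale $f$ to $\Xi\in[0,1]^S$ if $\rho_{f(|\sigma_j|)}(\pi,\sigma_j)\to\Xi_\pi$ for every $\pi\in S$. A scale limit is a vector $\Xi\in[0,1]^S$ such that for some scaling function $g$ there is a sequence of permutations converging at scale $g$ to $\Xi$. *)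

(* Defs.v *)
From Stdlib Require Import Reals.
From mathcomp Require Import all_boot fingroup perm.

Set Implicit Arguments.
Unset Strict Implicit.
Unset Printing Implicit Defensive.

Definition perm_any := {n : nat & 'S_n}.
Definition psize (s : perm_any) : nat := projT1 s.

Definition Rleb (x y : R) : bool := if Rle_dec x y then true else false.

(* A k-element subset {i_1 < ... < i_k} of [n] is represented by the strictly
   increasing map a |-> i_(a+1) from 'I_k to 'I_n (bijective correspondence). *)
Definition incr_map (k n : nat) (g : {ffun 'I_k -> 'I_n}) : bool :=
  [forall a : 'I_k, forall b : 'I_k, (a < b)%N ==> (g a < g b)%N].

Definition width (k n : nat) (g : {ffun 'I_k -> 'I_n}) : nat :=
  if k == 0%N then 0%N
  else ((\max_(a : 'I_k) (g a : nat)).+1 - \big[minn/n]_(a : 'I_k) (g a : nat))%N.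

Definition order_iso (k n : nat) (pi : 'S_k) (sigma : 'S_n)
  (g : {ffun 'I_k -> 'I_n}) : bool :=
  [forall a : 'I_k, forall b : 'I_k,
     (sigma (g a) < sigma (g b))%N == (pi a < pi b)%N].

Definition occ_count (k n : nat) (pi : 'S_k) (sigma : 'S_n) (f : R) : nat :=
  #|[set g : {ffun 'I_k -> 'I_n} |
       [&& incr_map g, order_iso pi sigma g & Rleb (INR (width g)) f]]|.

Definition sub_count (k n : nat) (f : R) : nat :=
  #|[set g : {ffun 'I_k -> 'I_n} | incr_map g && Rleb (INR (width g)) f]|.

Definition rho (k n : nat) (pi : 'S_k) (sigma : 'S_n) (f : R) : R :=
  Rdiv (INR (occ_count pi sigma f)) (INR (sub_count k n f)).

(* scaling function f : N -> R^+ (N = {1,2,...}) *)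
Definition scaling_function (f : nat -> R) : Prop :=
  (forall n : nat, (1 <= n)%N -> Rlt R0 (f n) /\ Rle (f n) (INR n)) /\
  (forall M : R, exists N : nat, forall n : nat, (N <= n)%N -> Rle M (f n)) /\
  Un_cv (fun n => Rdiv (f n) (INR n)) R0.

Definition converges_at_scale (f : nat -> R) (s : nat -> perm_any)
  (Xi : forall k : nat, 'S_k -> R) : Prop :=
  (forall M : nat, exists N : nat, forall j : nat, (N <= j)%N -> (M <= psize (s j))%N) /\
  (forall (k : nat) (pi : 'S_k),
     Un_cv (fun j => rho pi (projT2 (s j)) (f (psize (s j)))) (Xi k pi)).

Definition scale_limit (Xi : forall k : nat, 'S_k -> R) : Prop :=
  (forall (k : nat) (pi : 'S_k), Rle R0 (Xi k pi) /\ Rle (Xi k pi) R1) /\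
  exists g : nat -> R, scaling_function g /\
    exists s : nat -> perm_any, converges_at_scale g s Xi.

(* Main.v *)
(** Inflate every point of a permutation sigma of size n to an increasing run of
    r consecutive points, and repeat the result q times as a direct sum.  Almost
    all k-subsets of width at most w r in the new permutation tau meet k distinct
    runs of one copy, hence carry the pattern of a k-subset of sigma of width at
    most w, provided w is large and w / n is small.  Given sigma with window
    w = floor (g n), take N so large that f N is huge compared with w and N / f N
    is huge compared with n / w; then r = floor (f N) / w and
    q = N / (n r) give a tau of size N that at scale f looks like sigma at scale g.

    Only the easy inequality is needed: subsets of sigma lift to subsets of tau,
    both for those realising a pattern and for those not realising it.  As the
    total numbers of subsets nearly agree, both lower bounds are nearly tight. *)

Require Import Defs.
From Stdlib Require Import Reals Lra Lia IndefiniteDescription.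
From mathcomp Require Import all_boot fingroup perm zify.

(* The scope [ring_scope], loaded by [zify], also claims the key [R]. *)
Delimit Scope R_scope with R.

(** * Counting subsets of bounded width *)

Lemma incr_mapP (k n : nat) (g : {ffun 'I_k -> 'I_n}) :
  reflect (forall a b : 'I_k, a < b -> g a < g b) (incr_map g).
Proof.
apply: (iffP forallP) => [H a b ltab | H a].
  by move/forallP/(_ b)/implyP: (H a); apply.
by apply/forallP=> b; apply/implyP; apply: H.
Qed.

Lemma incr_map_leq (k n : nat) (g : {ffun 'I_k -> 'I_n}) (a b : 'I_k) :
  incr_map g -> a <= b -> g a <= g b.
Proof.
move=> /incr_mapP ig; rewrite leq_eqVlt => /orP[/eqP/val_inj-> // | /ig].
exact: ltnW.
Qed.

Lemma width_incr (m n : nat) (g : {ffun 'I_m.+1 -> 'I_n}) :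
  incr_map g -> width g = (g ord_max).+1 - g ord0.
Proof.
move=> ig; rewrite /width /=; congr (_.+1 - _).
  apply/eqP; rewrite eqn_leq; apply/andP; split.
    by apply/bigmax_leqP=> a _; apply: incr_map_leq; rewrite ?leq_ord.
  exact: (@leq_bigmax _ (fun a : 'I_m.+1 => g a : nat)).
apply/eqP; rewrite eqn_leq; apply/andP; split.
  have: ord0 \in index_enum 'I_m.+1 by rewrite mem_index_enum.
  elim: (index_enum _) => [|a s IH]; rewrite ?in_nil // big_cons inE.
  by case/orP=> [/eqP <-|/IH]; rewrite geq_min ?leqnn // => ->; rewrite orbT.
(* The default value [n] of the minimum lies above every value of [g], so it never wins. *)
elim/big_ind: _ => [|x y hx hy|a _]; first exact: ltnW.
  by rewrite leq_min hx hy.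
exact: incr_map_leq.
Qed.

(** The tuple of values of an increasing map is strictly sorted, and every strictly sorted tuple
    arises once in this way. *)
Lemma card_incr_map (m n : nat) :
  #|[set g : {ffun 'I_m -> 'I_n} | incr_map g]| = 'C(n, m).
Proof.
rewrite -card_ltn_sorted_tuples.
pose T (g : {ffun 'I_m -> 'I_n}) := [tuple g i | i < m].
have injT : injective T.
  move=> g h eq_gh; apply/ffunP=> i.
  by have := congr1 (fun t => tnth t i) eq_gh; rewrite !tnth_mktuple.
rewrite -(card_imset _ injT); congr #|pred_of_set _|; apply/setP=> t.
rewrite inE; apply/imsetP/idP.
  case=> g; rewrite inE => /incr_mapP ig ->.
  rewrite (sorted_pairwise ltn_trans) pairwise_map /T /=.
  rewrite pairwise_map; have : pairwise (fun i j : 'I_m => i < j) (enum 'I_m).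
    rewrite -[pairwise _ _](pairwise_map val ltn) val_enum_ord -(sorted_pairwise ltn_trans).
    exact: iota_ltn_sorted.
  by apply: sub_pairwise => i j; apply: ig.
rewrite (sorted_pairwise ltn_trans) => st.
exists [ffun i => tnth t i]; last first.
  by apply: eq_from_tnth => i; rewrite tnth_mktuple ffunE.
rewrite inE; apply/incr_mapP=> a b lt_ab; rewrite !ffunE.
have x0 := tnth t a.
move/(pairwiseP 0): st => /(_ a b); rewrite !inE !size_map size_tuple.
move=> /(_ (ltn_ord a) (ltn_ord b) lt_ab).
by rewrite !(nth_map x0) ?size_tuple // -!tnth_nth.
Qed.

Definition narrow (k n w : nat) : {set {ffun 'I_k -> 'I_n}} :=
  [set g | incr_map g & width g <= w].

(** A subset is determined by its least element and by the offsets of the other [m] elements from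
    the successor of that element. These offsets form an increasing map into ['I_w.+1], whose
    successor form makes [inord] available. *)
Lemma card_narrow_le (m n w : nat) :
  #|narrow m.+1 n w.+1| <= n * 'C(w.+1, m).
Proof.
rewrite -card_incr_map -[X in X * _]card_ord -cardsT -cardsX.
pose F (g : {ffun 'I_m.+1 -> 'I_n}) :=
  (g ord0, [ffun i : 'I_m => inord (g (lift ord0 i) - (g ord0).+1) : 'I_w.+1]).
have bd (g : {ffun 'I_m.+1 -> 'I_n}) (i : 'I_m) : g \in narrow m.+1 n w.+1 ->
    g ord0 < g (lift ord0 i) /\ g (lift ord0 i) - (g ord0).+1 < w.+1.
  rewrite inE => /andP[ig]; rewrite width_incr // => wg.
  have := incr_map_leq _ _ g (lift ord0 i) ord_max ig (leq_ord _).
  move/incr_mapP: ig => /(_ ord0 (lift ord0 i) isT) lt0i lei.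
  split=> //; rewrite ltnS leq_subLR; apply: leq_trans lei _.
  by move: wg; rewrite leq_subLR addnS addSn ltnS; apply: leqW.
have injF : {in narrow m.+1 n w.+1 &, injective F}.
  move=> g h ng nh [e0 /ffunP e]; apply/ffunP=> i.
  case: (unliftP ord0 i) => [j|] -> //; apply: val_inj => /=.
  have := congr1 val (e j); rewrite !ffunE /=.
  have [? ?] := bd g j ng; have [? ?] := bd h j nh.
  by rewrite !inordK // => /eqP; rewrite -e0 eqn_sub2rE // ?e0 // => /eqP.
rewrite -(card_in_imset injF); apply: subset_leq_card; apply/subsetP=> _ /imsetP[g ng ->].
rewrite !inE /=; apply/incr_mapP=> a b lt_ab; rewrite !ffunE.
have [? ?] := bd g a ng; have [? ?] := bd g b ng.
rewrite !inordK //.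
move: ng; rewrite inE => /andP[/incr_mapP ig _].
by have := ig (lift ord0 a) (lift ord0 b) lt_ab; lia.
Qed.

(** Any of the first [n - w] positions can serve as least element, and any [m] of the next [w - 1]
    positions complete it to a subset of width at most [w]. *)
Lemma card_narrow_ge (m n w : nat) :
  0 < w <= n -> (n - w) * 'C(w.-1, m) <= #|narrow m.+1 n w|.
Proof.
case: n => [|n] /andP[w0 wn]; first by lia.
rewrite -card_incr_map -[X in X * _]card_ord -cardsT -cardsX.
pose F (p : 'I_(n.+1 - w) * {ffun 'I_m -> 'I_w.-1}) : {ffun 'I_m.+1 -> 'I_n.+1} :=
  [ffun i => inord (if unlift ord0 i is Some j then (p.1 + p.2 j).+1 else p.1)].
have F0 p : F p ord0 = p.1 :> nat.
  by rewrite ffunE unlift_none inordK //; have := ltn_ord p.1; lia.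
have FS p j : F p (lift ord0 j) = (p.1 + p.2 j).+1 :> nat.
  rewrite ffunE liftK inordK //; have := ltn_ord p.1; have := ltn_ord (p.2 j).
  by lia.
have injF : injective F.
  move=> [x g] [y h] eF.
  have exy : x = y by apply: val_inj; rewrite /= -(F0 (x, g)) eF F0.
  congr (_, _); rewrite // ; apply/ffunP=> j; apply: val_inj => /=.
  by have := FS (x, g) j; rewrite eF FS /= exy; lia.
rewrite -(card_imset _ injF).
apply: subset_leq_card; apply/subsetP=> _ /imsetP[[x g] + ->].
rewrite !inE /= => /incr_mapP ig.
have iF : incr_map (F (x, g)).
  apply/incr_mapP=> a b.
  case: (unliftP ord0 a) => [a'|] ->; case: (unliftP ord0 b) => [b'|] -> //.
    by rewrite !FS /= => h; have := ig a' b' h; lia.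
  by rewrite F0 FS /=; lia.
rewrite iF /= width_incr // F0 /=; move: ord_max => i.
case: (unliftP ord0 i) => [j|] ->; last by rewrite F0 /=; lia.
rewrite FS /=; have: g j < w.-1 := ltn_ord _.
by move: (nat_of_ord (g j)) (nat_of_ord x) => a b; lia.
Qed.

Lemma ffact_le_exp (n m : nat) : n ^_ m <= n ^ m.
Proof.
elim: m n => [|m IH] n //; rewrite ffactnS expnS leq_mul //.
apply: leq_trans (IH _) _; case: m {IH} => [|m]; first by rewrite !expn0.
by rewrite leq_exp2r ?leq_pred.
Qed.

(** The smallest factor of the falling factorial is [n - m + 1]. *)
Lemma exp_le_ffact (n m : nat) : (n.+1 - m) ^ m <= n ^_ m.
Proof.
elim: m n => [|m IH] n //; rewrite ffactnS expnS subSS.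
case: m IH => [|m] IH; first by rewrite expn0 ffactn0 subn0.
case: n => [|n]; first by rewrite sub0n mul0n.
by apply: leq_mul; [lia | exact: IH].
Qed.

(** * Inflating a permutation *)

(* Position (or value) of the c-th point of the run replacing a in the b-th copy. *)
Definition blowup_pos (n r b a c : nat) : nat := (b * n + a) * r + c.

Lemma blowup_pos_inj (n r b a c b' a' c' : nat) :
  a < n -> a' < n -> c < r -> c' < r ->
  blowup_pos n r b a c = blowup_pos n r b' a' c' ->
  [/\ b = b', a = a' & c = c'].
Proof.
move=> an a'n cr c'r e.
have r0 : 0 < r by apply: leq_ltn_trans cr.
have n0 : 0 < n by apply: leq_ltn_trans an.
have e1 : b * n + a = b' * n + a'.
  have := congr1 (divn^~ r) e.
  by rewrite /blowup_pos !divnMDl // !divn_small // !addn0.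
have ec : c = c'.
  by have := congr1 (modn^~ r) e; rewrite /blowup_pos !modnMDl !modn_small.
have := congr1 (divn^~ n) e1; have := congr1 (modn^~ n) e1.
by rewrite !modnMDl !modn_small // !divnMDl // !divn_small // !addn0.
Qed.

Lemma blowup_pos_lt (n r q b a c : nat) :
  b < q -> a < n -> c < r -> blowup_pos n r b a c < q * n * r.
Proof.
move=> ltb lta ltc; rewrite /blowup_pos.
have le1 : (b * n + a).+1 <= q * n.
  by apply: leq_trans (leq_mul ltb (leqnn n)); rewrite mulSn; lia.
by apply: leq_trans (leq_mul le1 (leqnn r)); rewrite mulSn; lia.
Qed.

Lemma blowup_pos_eq (n r i : nat) :
  i = blowup_pos n r (i %/ r %/ n) (i %/ r %% n) (i %% r).
Proof. by rewrite /blowup_pos -!divn_eq. Qed.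

(** Positions beyond the [q] copies are left unconstrained, so that [N] can be any size with room
    for the copies and not only a multiple of [n * r]. *)
Definition is_blowup (q r n N : nat) (sigma : 'S_n) (tau : 'S_N) : Prop :=
  forall (b c : nat) (a : 'I_n) (i : 'I_N), b < q -> c < r ->
    i = blowup_pos n r b a c :> nat ->
    tau i = blowup_pos n r b (sigma a) c :> nat.

Lemma blowup_exists (q r n N : nat) (sigma : 'S_n) :
  0 < n -> 0 < r -> q * n * r <= N ->
  exists tau : 'S_N, is_blowup q r n N sigma tau.
Proof.
case: n sigma => // n sigma _ r0 leN.
pose v i := blowup_pos n.+1 r (i %/ r %/ n.+1) (sigma (inord (i %/ r %% n.+1))) (i %% r).
(* Since [v] maps the initial segment of length [q n r] into itself, extending it by the identity
   keeps injectivity. *)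
pose t (i : 'I_N) : 'I_N := if i < q * n.+1 * r then insubd i (v i) else i.
have v_lt i : i < q * n.+1 * r -> v i < q * n.+1 * r.
  move=> lti; apply: blowup_pos_lt; rewrite ?ltn_mod //.
  by rewrite !ltn_divLR.
have tE (i : 'I_N) : t i = (if i < q * n.+1 * r then v i else i) :> nat.
  rewrite /t; case: ifP => // lti.
  by rewrite insubdK // unfold_in; apply: leq_trans leN; apply: v_lt.
have t_inj : injective t.
  move=> i j eij; apply: val_inj => /=; move: (congr1 (@nat_of_ord N) eij).
  rewrite !tE; case: ifP => lti; case: ifP => ltj //.
  - move=> /blowup_pos_inj[]; rewrite ?ltn_mod ?ltn_ord //.
    move=> eb /val_inj/perm_inj/(congr1 val) /= ea ec.
    rewrite (blowup_pos_eq n.+1 r i) (blowup_pos_eq n.+1 r j) eb ec.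
    by move: ea; rewrite !inordK ?ltn_mod // => ->.
  - by move=> e; move: (v_lt _ lti); rewrite e ltj.
  - by move=> e; move: (v_lt _ ltj); rewrite -e lti.
exists (perm t_inj) => b c a i ltb ltc ei.
rewrite permE tE ei blowup_pos_lt //.
have divr : blowup_pos n.+1 r b a c %/ r = b * n.+1 + a.
  by rewrite /blowup_pos divnMDl // divn_small ?addn0.
rewrite /v divr divnMDl // modnMDl divn_small ?ltn_ord // modn_small ?ltn_ord //.
by rewrite inord_val addn0 {2}/blowup_pos modnMDl modn_small.
Qed.

(** The chosen points lie in one copy and, as [g] is strictly increasing, in distinct runs. Values
    in distinct runs compare as the corresponding values of [sigma], because the offsets stay below
    [r]. *)
Lemma order_iso_blowup (q r n N m : nat) (sigma : 'S_n) (tau : 'S_N)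
    (pi : 'S_m) (b : nat) (g : {ffun 'I_m -> 'I_n}) (c : {ffun 'I_m -> 'I_r})
    (h : {ffun 'I_m -> 'I_N}) :
  is_blowup q r n N sigma tau -> b < q -> incr_map g ->
  (forall i, h i = blowup_pos n r b (g i) (c i) :> nat) ->
  order_iso pi tau h = order_iso pi sigma g.
Proof.
move=> bl ltb /incr_mapP ig hE.
apply: eq_forallb => i; apply: eq_forallb => j; congr (_ == _).
rewrite !(bl b _ _ _ ltb (ltn_ord _) (hE _)).
have [->|neq_ij] := eqVneq i j; first by rewrite !ltnn.
have neq_s : sigma (g i) != sigma (g j) :> nat.
  apply: contra neq_ij => /eqP/val_inj/perm_inj eg; apply/eqP/val_inj.
  have : g i = g j :> nat by rewrite eg.
  by case: (ltngtP i j) => // /ig; lia.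
have := ltn_ord (c i); have := ltn_ord (c j); rewrite /blowup_pos.
move: neq_s; move: (nat_of_ord (sigma (g i))) (nat_of_ord (sigma (g j))).
move: (nat_of_ord (c i)) (nat_of_ord (c j)) => ci cj x y neq ltj lti.
by case: (ltngtP x y) neq => // xy _; apply/idP/idP; nia.
Qed.

(** A lift of [g] is a choice of one of the [q] copies and of one of [r] points in each of the
    [m + 1] runs. Distinct choices give distinct subsets, the width grows at most by the factor [r],
    and [e] covers occurrences and non-occurrences alike. *)
Lemma card_blowup (q r n N m w W : nat) (sigma : 'S_n) (tau : 'S_N)
    (pi : 'S_m.+1) (e : bool) :
  is_blowup q r n N sigma tau -> q * n * r <= N -> w * r <= W ->
  q * r ^ m.+1 * #|[set g in narrow m.+1 n w | order_iso pi sigma g == e]|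
  <= #|[set h in narrow m.+1 N W | order_iso pi tau h == e]|.
Proof.
move=> bl leN leW; set D := [set g in _ | _].
have -> : q * r ^ m.+1 * #|D| =
    #|setX (setX [set: 'I_q] [set: {ffun 'I_m.+1 -> 'I_r}]) D|.
  by rewrite !cardsX !cardsT card_ffun !card_ord.
pose F (p : 'I_q * {ffun 'I_m.+1 -> 'I_r} * {ffun 'I_m.+1 -> 'I_n}) :
    {ffun 'I_m.+1 -> 'I_N} :=
  [ffun i => widen_ord leN
     (Ordinal (blowup_pos_lt n r q p.1.1 (p.2 i) (p.1.2 i)
                 (ltn_ord _) (ltn_ord _) (ltn_ord _)))].
have FE b c g i : F (b, c, g) i = blowup_pos n r b (g i) (c i) :> nat.
  by rewrite ffunE.
have injF : injective F.
  move=> [[b c] g] [[b' c'] g'] eF.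
  have eb i : [/\ b = b' :> nat, g i = g' i :> nat & c i = c' i :> nat].
    apply: (@blowup_pos_inj n r) => //.
    by rewrite -!FE eF.
  have [/val_inj-> _ _] := eb ord0.
  by congr (_, _, _); apply/ffunP=> i; apply: val_inj; case: (eb i).
rewrite -(card_imset _ injF); apply: subset_leq_card.
apply/subsetP=> _ /imsetP[[[b c] g] + ->].
rewrite !inE /= -!andbA => /and3P[ig wg iso_g].
rewrite (order_iso_blowup q r n N m.+1 sigma tau pi b g c) // iso_g andbT.
move/incr_mapP: (ig) => ig'.
have iF : incr_map (F (b, c, g)).
  apply/incr_mapP=> i j /ig'; rewrite !FE /blowup_pos.
  have : c i < r := ltn_ord _; have : c j < r := ltn_ord _.
  move: (nat_of_ord (g i)) (nat_of_ord (g j)) => x y.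
  by move: (nat_of_ord (c i)) (nat_of_ord (c j)) => ci cj; nia.
rewrite iF width_incr // !FE /=; apply: leq_trans leW.
have : c ord_max < r := ltn_ord _.
move: wg; rewrite width_incr // /blowup_pos.
move: (nat_of_ord (g ord_max)) (nat_of_ord (g ord0)) => x y.
move: (nat_of_ord (c ord_max)) (nat_of_ord (c ord0)) (nat_of_ord b) => ci cj z.
move=> h1 h2.
have : x.+1 <= w + y by lia.
by nia.
Qed.

(** * Pattern densities as ratios of counts *)

Definition is_floor (x : R) (w : nat) : Prop := (INR w <= x < INR w + 1)%R.

Lemma is_floor_exists (x : R) : (0 <= x)%R -> exists w, is_floor x w.
Proof.
move=> x0; have [up1 up2] := archimed x.
have up0 : (0 < up x)%Z by apply: lt_IZR; lra.
exists (Z.to_nat (up x - 1)); rewrite /is_floor INR_IZR_INZ.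
by rewrite Znat.Z2Nat.id ?minus_IZR; [lra | lia].
Qed.

Lemma is_floor_uniq (x : R) (v w : nat) : is_floor x v -> is_floor x w -> v = w.
Proof.
move=> [h1 h2] [h3 h4].
have : (INR w < INR v.+1)%R by rewrite S_INR; lra.
have : (INR v < INR w.+1)%R by rewrite S_INR; lra.
by move=> /INR_lt ? /INR_lt ?; lia.
Qed.

Lemma Rleb_floor (x : R) (v w : nat) : is_floor x w -> Rleb (INR v) x = (v <= w).
Proof.
move=> [h1 h2]; rewrite /Rleb; case: Rle_dec => h; symmetry.
  suff : (v < w.+1)%coq_nat by move/ltP.
  by apply: INR_lt; rewrite S_INR; lra.
apply/negbTE/negP => le_vw; apply: h.
by apply: Rle_trans h1; apply: le_INR; lia.
Qed.

(** Widths are integers, so a real scale acts only through its floor. *)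
Lemma rho_floor (k n : nat) (pi : 'S_k) (sigma : 'S_n) (x : R) (w : nat) :
  is_floor x w ->
  rho pi sigma x =
    (INR #|[set g in narrow k n w | order_iso pi sigma g == true]| /
     INR #|narrow k n w|)%R.
Proof.
move=> fl; rewrite /rho /occ_count /Defs.sub_count.
congr (INR _ / INR _)%R; apply: eq_card => g; rewrite !inE (Rleb_floor _ _ _ fl) //.
by rewrite eqb_id -andbA; congr andb; rewrite andbC.
Qed.

(** The counting bounds concern nonempty subsets; for [k = 0] the only subset is empty, has width 0
    and is an occurrence. *)
Lemma rho_empty_pattern (n : nat) (pi : 'S_0) (sigma : 'S_n) (x : R) :
  (0 <= x)%R -> rho pi sigma x = 1%R.
Proof.
move=> x0; rewrite /rho.
have oneP : Rleb 0 x by rewrite /Rleb; case: Rle_dec.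
have all_incr (g : {ffun 'I_0 -> 'I_n}) : incr_map g by apply/incr_mapP; case.
have -> : Defs.sub_count 0 n x = 1.
  rewrite -[RHS](_ : #|{ffun 'I_0 -> 'I_n}| = 1); last first.
    by rewrite card_ffun !card_ord expn0.
  by apply: eq_card => g; rewrite !inE all_incr.
have -> : occ_count pi sigma x = 1.
  rewrite -[RHS](_ : #|{ffun 'I_0 -> 'I_n}| = 1); last first.
    by rewrite card_ffun !card_ord expn0.
  apply: eq_card => g; rewrite !inE all_incr oneP andbT /=.
  by apply/forallP; case.
by rewrite /= Rdiv_1_r.
Qed.

Lemma card_narrow_split (k n w : nat) (pi : 'S_k) (sigma : 'S_n) :
  #|narrow k n w| = #|[set g in narrow k n w | order_iso pi sigma g == true]|
    + #|[set g in narrow k n w | order_iso pi sigma g == false]|.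
Proof.
rewrite -(cardsID [set g | order_iso pi sigma g] (narrow k n w)).
by congr (_ + _); apply: eq_card => g; rewrite !inE ?eqb_id ?eqbF_neg // andbC.
Qed.

(* [a / (a + a')] may be [0 / 0 = 0]; the hypotheses then force [E >= 1] or [b = 0]. *)
Lemma ratio_close (a a' b b' c E : R) :
  (0 <= a -> 0 <= a' -> 0 <= b -> 0 <= b' -> 0 < c -> 0 <= E ->
   c * a <= b -> c * a' <= b' -> (1 - E) * (b + b') <= c * (a + a') ->
   Rabs (b / (b + b') - a / (a + a')) <= E)%R.
Proof.
move=> a0 a'0 b0 b'0 c0 E0 ab ab' tot.
have frac x y : (0 <= x -> 0 <= y -> 0 <= x / (x + y) <= 1)%R.
  move=> x0 y0; have [z|nz] := Req_dec (x + y) 0.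
    by rewrite z /Rdiv Rinv_0; lra.
  split; first by apply: Rle_mult_inv_pos; lra.
  apply: (Rmult_le_reg_r (x + y)); first by lra.
  by rewrite /Rdiv Rmult_assoc Rinv_l // Rmult_1_r; lra.
(* Both ratios lie in [[0, 1]], so only [E < 1] has content. *)
have [E1|E1] := Rle_lt_dec 1 E.
  by apply: Rabs_le; have := frac _ _ a0 a'0; have := frac _ _ b0 b'0; lra.
have [B0|B0] := Req_dec (b + b') 0.
  have -> : b = 0%R by lra.
  have -> : a = 0%R by nra.
  by rewrite /Rdiv !Rmult_0_l Rminus_0_r Rabs_R0.
have A0 : (0 < a + a')%R by nra.
have Bp : (0 < b + b')%R by lra.
have h1 : (b / (b + b') * (b + b') = b)%R by field.
have h2 : (a / (a + a') * (a + a') = a)%R by field; lra.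
have := frac _ _ a0 a'0.
move: h1 h2; set u := (b / _)%R; set v := (a / _)%R => h1 h2 [v0 v1].
apply: Rabs_le; split.
  (* Here [b >= c a = v c (a + a') >= v (1 - E) (b + b')], and [v <= 1]. *)
  have : ((v - E) * (b + b') <= u * (b + b'))%R.
    have : (v * ((1 - E) * (b + b')) <= v * (c * (a + a')))%R.
      exact: Rmult_le_compat_l.
    have : (v * E * (b + b') <= 1 * E * (b + b'))%R.
      by apply: Rmult_le_compat_r; [lra | apply: Rmult_le_compat_r].
    by nra.
  by move/(Rmult_le_reg_r _ _ _ Bp); lra.
(* The same argument for the complementary ratio [1 - v], starting from [b' >= c a']. *)
have : (u * (b + b') <= (v + E) * (b + b'))%R.
  have : ((1 - v) * ((1 - E) * (b + b')) <= (1 - v) * (c * (a + a')))%R.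
    by apply: Rmult_le_compat_l => //; lra.
  have : (0 <= v * E * (b + b'))%R.
    by apply: Rmult_le_pos; [apply: Rmult_le_pos | lra].
  by nra.
by move/(Rmult_le_reg_r _ _ _ Bp); lra.
Qed.

Lemma INR_mul (a b : nat) : INR (a * b) = (INR a * INR b)%R.
Proof. exact: mult_INR. Qed.

Lemma INR_exp (a b : nat) : INR (a ^ b) = (INR a ^ b)%R.
Proof. by elim: b => // b IH; rewrite expnS INR_mul IH. Qed.

Lemma INR_leq (a b : nat) : a <= b -> (INR a <= INR b)%R.
Proof. by move=> h; apply: le_INR; lia. Qed.

Lemma INR_ltn (a b : nat) : a < b -> (INR a < INR b)%R.
Proof. by move=> h; apply: lt_INR; lia. Qed.

Lemma rho_blowup (q r n N m w W : nat) (sigma : 'S_n) (tau : 'S_N)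
    (pi : 'S_m.+1) (x y E : R) :
  is_blowup q r n N sigma tau -> q * n * r <= N -> w * r <= W ->
  0 < q -> 0 < r -> is_floor x w -> is_floor y W -> (0 <= E)%R ->
  ((1 - E) * INR #|narrow m.+1 N W| <=
     INR (q * r ^ m.+1) * INR #|narrow m.+1 n w|)%R ->
  (Rabs (rho pi tau y - rho pi sigma x) <= E)%R.
Proof.
move=> bl leN leW q0 r0 fx fy E0 tot.
rewrite (rho_floor _ _ pi tau y W) // (rho_floor _ _ pi sigma x w) //.
move: tot; rewrite (card_narrow_split _ N W pi tau) (card_narrow_split _ n w pi sigma).
rewrite !plus_INR => tot.
apply: ratio_close tot => //; try exact: pos_INR.
- apply: (INR_ltn 0); by rewrite muln_gt0 q0 expn_gt0 r0.
- rewrite -INR_mul; apply: INR_leq; exact: card_blowup.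
- rewrite -INR_mul; apply: INR_leq; exact: card_blowup.
Qed.

(** * The proportion of lifted subsets *)

Lemma bernoulli_sub (x : R) (m : nat) :
  (0 <= x <= 1 -> 1 - INR m * x <= (1 - x) ^ m)%R.
Proof.
move=> [x0 x1]; elim: m => [|m IH]; first by rewrite /=; lra.
rewrite S_INR -tech_pow_Rmult.
apply: (Rle_trans _ ((1 - x) * (1 - INR m * x))%R).
  by have := pos_INR m; nra.
by apply: Rmult_le_compat_l; lra.
Qed.

(* With W = floor (f N), m = k - 1, r = W / w and q = N / (n r), the lifted
   subsets are a proportion of at least about
   (q n r / N) (1 - w / n) (r (w - m) / W)^m of all of them; d bounds w / W and n r / N. *)
Definition blowup_error (d : R) (n w k : nat) : R :=
  (d * INR k + INR w / INR n + INR k * INR k / INR w)%R.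

Lemma blowup_error_ge0 (d : R) (n w k : nat) :
  (0 <= d)%R -> 0 < n -> 0 < w -> (0 <= blowup_error d n w k)%R.
Proof.
move=> d0 /(INR_ltn 0) /= n0 /(INR_ltn 0) /= w0.
have k0 := pos_INR k.
have h1 : (0 <= d * INR k)%R by apply: Rmult_le_pos.
have h2 : (0 <= INR w / INR n)%R by apply: Rle_mult_inv_pos; lra.
have h3 : (0 <= INR k * INR k / INR w)%R by apply: Rle_mult_inv_pos; nra.
by rewrite /blowup_error; lra.
Qed.

Lemma blowup_density (d : R) (n N m w W : nat) :
  let r := W %/ w in let q := N %/ (n * r) in
  (0 < d <= 1)%R -> 0 < w <= n -> 0 < W ->
  (INR w <= d * INR W)%R -> (INR n * INR W <= d * INR w * INR N)%R ->
  ((1 - blowup_error d n w m.+1) * INR #|narrow m.+1 N W| <=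
     INR (q * r ^ m.+1) * INR #|narrow m.+1 n w|)%R.
Proof.
move=> r q [d0 d1] /andP[w0 wn] W0 hW hN.
set E := blowup_error _ _ _ _.
(* If [E >= 1] the left side is nonpositive. Otherwise [E < 1] makes all the factors below positive
   and forces [m < w]. *)
have [p0|p0] := Rle_lt_dec (1 - E) 0.
  apply: (Rle_trans _ 0).
    by have := pos_INR #|narrow m.+1 N W|; nra.
  by apply: Rmult_le_pos; exact: pos_INR.
have n0 : 0 < n by lia.
have Rw0 : (0 < INR w)%R by exact: (INR_ltn 0).
have Rn0 : (0 < INR n)%R by exact: (INR_ltn 0).
have RW0 : (0 < INR W)%R by exact: (INR_ltn 0).
have Rm0 := pos_INR m.
have Rwn : (INR w <= INR n)%R by exact: INR_leq.
set x := (INR m / INR w)%R; set y := (INR w / INR n)%R.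
have xw : (x * INR w = INR m)%R by rewrite /x; field; lra.
have yn : (y * INR n = INR w)%R by rewrite /y; field; lra.
have x0 : (0 <= x)%R by apply: Rle_mult_inv_pos.
have y0 : (0 <= y)%R by apply: Rle_mult_inv_pos; lra.
(* With [k = m + 1], the term [k^2 / w] is [m x + 2 x + 1 / w]. The final product loses at most
   [(d + y) + m (d + x)], which is at most [E]. *)
have EE : (E = d * (INR m + 1) + y + (INR m * x + 2 * x + / INR w))%R.
  by rewrite /E /blowup_error S_INR /x /y; field; lra.
have iw0 : (0 < / INR w)%R by exact: Rinv_0_lt_compat.
have mx0 : (0 <= INR m * x)%R by exact: Rmult_le_pos.
have md0 : (0 <= INR m * d)%R by apply: Rmult_le_pos; lra.
have lt_xd : (d + x < 1)%R by lra.
have ltmw : m < w.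
  have : (INR m < INR w)%R by nra.
  by move/INR_lt; lia.
(* Multiplying by the factorial of [m] turns the binomials into falling factorials, which are then
   compared with powers. *)
have up : (INR #|narrow m.+1 N W| * INR m`! <= INR N * INR W ^ m)%R.
  rewrite -INR_exp -!INR_mul; apply: INR_leq.
  move: W0 (card_narrow_le m N W.-1) => /prednK-> le.
  apply: leq_trans (leq_mul le (leqnn _)) _.
  by rewrite -mulnA bin_ffact leq_mul // ffact_le_exp.
have lo : (INR (n - w) * INR (w - m) ^ m <= INR #|narrow m.+1 n w| * INR m`!)%R.
  rewrite -INR_exp -!INR_mul; apply: INR_leq.
  apply: leq_trans (leq_mul (card_narrow_ge m n w _) (leqnn _)); last by rewrite w0.
  by rewrite -mulnA bin_ffact leq_mul // -{1}(prednK w0) exp_le_ffact.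
(* Rounding [W / w] down costs at most [w <= d W]; replacing [w] by [w - m] costs the factor
   [1 - x]. *)
have r_lo : (INR W * (1 - (d + x)) <= INR r * INR (w - m))%R.
  rewrite minus_INR; last by lia.
  have : (INR W - INR w <= INR r * INR w)%R.
    rewrite -INR_mul.
    have : (INR W <= INR (r * w + w))%R.
      by apply: INR_leq; rewrite /r {1}(divn_eq W w) leq_add2l ltnW // ltn_mod.
    by rewrite plus_INR; lra.
  move=> rw.
  have -> : (INR r * (INR w - INR m) = INR r * INR w * (1 - x))%R.
    by rewrite -xw; ring.
  apply: (Rle_trans _ ((INR W - INR w) * (1 - x))%R); last first.
    by apply: Rmult_le_compat_r => //; lra.
  apply: (Rle_trans _ (INR W * (1 - d) * (1 - x))%R); last first.
    by apply: Rmult_le_compat_r; lra.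
  by have : (0 <= INR W * (d * x))%R; [apply: Rmult_le_pos; nra | lra].
(* Likewise, rounding [N / (n r)] down costs at most [n r <= d N]; replacing [n] by [n - w] costs
   the factor [1 - y]. *)
have q_lo : (INR N * (1 - (d + y)) <= INR q * INR r * INR (n - w))%R.
  rewrite minus_INR; last by lia.
  have rw : (INR r * INR w <= INR W)%R.
    by rewrite -INR_mul; apply: INR_leq; exact: leq_divM.
  have nr : (INR n * INR r <= d * INR N)%R.
    apply: (Rmult_le_reg_r (INR w)) => //.
    by have : (INR n * (INR r * INR w) <= INR n * INR W)%R; [nra | lra].
  have qnr : (INR N - INR n * INR r <= INR q * (INR n * INR r))%R.
    rewrite -!INR_mul.
    have : (INR N <= INR (q * (n * r) + n * r))%R.
      apply: INR_leq; rewrite /q {1}(divn_eq N (n * r)) leq_add2l ltnW //.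
      rewrite ltn_mod muln_gt0 n0 /r divn_gt0 //.
      suff : (INR w <= INR W)%R by move/INR_le; lia.
      by nra.
    by rewrite plus_INR; lra.
  have N0 := pos_INR N.
  have y1 : (y <= 1)%R by lra.
  have -> : (INR q * INR r * (INR n - INR w) = INR q * (INR n * INR r) * (1 - y))%R.
    by rewrite -yn; ring.
  apply: (Rle_trans _ (INR N * (1 - d) * (1 - y))%R); last first.
    by apply: Rmult_le_compat_r; lra.
  by have : (0 <= INR N * (d * y))%R; [apply: Rmult_le_pos; nra | lra].
have f0 : (0 < INR m`!)%R by apply: (INR_ltn 0); exact: fact_gt0.
apply: (Rmult_le_reg_r (INR m`!)) => //.
apply: (Rle_trans _ ((1 - E) * (INR N * INR W ^ m))%R).
  by rewrite Rmult_assoc; apply: Rmult_le_compat_l; lra.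
apply: (Rle_trans _ (INR (q * r ^ m.+1) * (INR (n - w) * INR (w - m) ^ m))%R); last first.
  by rewrite Rmult_assoc; apply: Rmult_le_compat_l => //; exact: pos_INR.
rewrite INR_mul INR_exp -tech_pow_Rmult.
(* One factor [r] joins [q (n - w)], to be compared with [N]; the other [m] join the factors
   [w - m], each to be compared with [W]. *)
have -> : (INR q * (INR r * INR r ^ m) * (INR (n - w) * INR (w - m) ^ m) =
           (INR q * INR r * INR (n - w)) * (INR r * INR (w - m)) ^ m)%R.
  by rewrite Rpow_mult_distr; ring.
apply: (Rle_trans _ ((INR N * (1 - (d + y))) * (INR W * (1 - (d + x))) ^ m)%R); last first.
  have N0 := pos_INR N.
  apply: Rmult_le_compat => //; first by apply: Rmult_le_pos; lra.
    by apply: pow_le; apply: Rmult_le_pos; lra.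
  by apply: pow_incr; split=> //; apply: Rmult_le_pos; lra.
rewrite Rpow_mult_distr.
have -> : (INR N * (1 - (d + y)) * (INR W ^ m * (1 - (d + x)) ^ m) =
  (1 - (d + y)) * (1 - (d + x)) ^ m * (INR N * INR W ^ m))%R by ring.
apply: Rmult_le_compat_r.
  by apply: Rmult_le_pos; [exact: pos_INR | apply: pow_le; lra].
apply: (Rle_trans _ ((1 - (d + y)) * (1 - INR m * (d + x)))%R); last first.
  by apply: Rmult_le_compat_l; [lra | apply: bernoulli_sub; lra].
have : (0 <= (d + y) * (INR m * (d + x)))%R by apply: Rmult_le_pos; nra.
by lra.
Qed.

(** * Rescaling one permutation *)

(** Divergence of [f] makes [w / W] small, and [f N / N] tending to 0 makes [n W / (w N)] small; [N]
    is taken beyond both thresholds. *)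
Lemma scaling_choose (f : nat -> R) (d : R) (n w M : nat) :
  scaling_function f -> (0 < d)%R -> 0 < n -> 0 < w ->
  exists N W : nat, [/\ M < N, 0 < W, is_floor (f N) W,
    (INR w <= d * INR W)%R & (INR n * INR W <= d * INR w * INR N)%R].
Proof.
move=> [f_pos [f_inf f_small]] d0 n0 w0.
have Rw0 : (0 < INR w)%R by exact: (INR_ltn 0).
have Rn0 : (0 < INR n)%R by exact: (INR_ltn 0).
(* The added 1 pays for passing from [f N] to its floor [W]. *)
have [N1 hN1] := f_inf (INR w / d + 1)%R.
have e0 : (d * INR w / INR n > 0)%R.
  by apply: Rdiv_lt_0_compat => //; apply: Rmult_lt_0_compat.
have [N2 hN2] := f_small _ e0.
pose N := (M + N1 + N2).+1.
have N0 : 0 < N by [].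
have RN0 : (0 < INR N)%R by exact: (INR_ltn 0).
have [fN0 _] := f_pos N N0.
have [W fW] := is_floor_exists (f N) (Rlt_le _ _ fN0).
have hW : (INR w / d < INR W)%R.
  have /hN1 : N1 <= N by rewrite /N; lia.
  by case: fW; lra.
have wd : (INR w / d * d = INR w)%R by field; lra.
have wd0 : (0 < INR w / d)%R by apply: Rdiv_lt_0_compat.
exists N, W; split=> //.
- by rewrite /N; lia.
- have : (INR 0 < INR W)%R by rewrite /=; lra.
  by move/INR_lt; lia.
- by nra.
have /hN2 : (N >= N2)%coq_nat by rewrite /N; lia.
rewrite /Rdist Rminus_0_r => /Rabs_def2[h _].
have {}h : (f N <= d * INR w / INR n * INR N)%R.
  apply: Rlt_le; apply: (Rmult_lt_reg_r (/ INR N)); first exact: Rinv_0_lt_compat.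
  by rewrite Rmult_assoc Rinv_r ?Rmult_1_r //; lra.
have : (INR n * INR W <= INR n * (d * INR w / INR n * INR N))%R.
  by apply: Rmult_le_compat_l; [lra | case: fW; lra].
by have -> : (INR n * (d * INR w / INR n * INR N) = d * INR w * INR N)%R by field; lra.
Qed.

(** The choice of [N], [q] and [r] does not involve [k], so a single permutation serves all patterns
    at once, as the final sequence requires. *)
Lemma rescale (f : nat -> R) (n w M : nat) (sigma : 'S_n) (x d : R) :
  scaling_function f -> 0 < w <= n -> is_floor x w -> (0 < d <= 1)%R ->
  exists t : perm_any, M <= psize t /\
    forall (k : nat) (pi : 'S_k),
      (Rabs (rho pi (projT2 t) (f (psize t)) - rho pi sigma x) <=
         blowup_error d n w k)%R.
Proof.
move=> sf /andP[w0 wn] fx [d0 d1]; have n0 : 0 < n by lia.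
have [N [W [MN W0 fW hW hN]]] := scaling_choose f d n w M sf d0 n0 w0.
have wW : w <= W.
  have := pos_INR W => ?; suff : (INR w <= INR W)%R by move/INR_le; lia.
  by nra.
pose r := W %/ w; pose q := N %/ (n * r).
have r0 : 0 < r by rewrite divn_gt0.
have nrN : n * r <= N.
  have RW0 : (0 < INR w)%R by exact: (INR_ltn 0).
  suff : (INR (n * r) <= INR N)%R by move/INR_le; lia.
  rewrite INR_mul; apply: (Rmult_le_reg_r (INR w)) => //.
  have : (INR r * INR w <= INR W)%R.
    by rewrite -INR_mul; apply: INR_leq; exact: leq_divM.
  move=> h; have : (INR n * (INR r * INR w) <= INR n * INR W)%R.
    by apply: Rmult_le_compat_l => //; exact: pos_INR.
  have : (d * (INR w * INR N) <= 1 * (INR w * INR N))%R.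
    by apply: Rmult_le_compat_r => //; apply: Rmult_le_pos; exact: pos_INR.
  by lra.
have q0 : 0 < q by rewrite divn_gt0 // muln_gt0 n0.
have qnr : q * n * r <= N by rewrite -mulnA leq_divM.
have [tau bl] := blowup_exists q r n N sigma n0 r0 qnr.
exists (existT _ N tau); split; first exact: ltnW.
case=> [|m] pi.
  rewrite /= !rho_empty_pattern.
  - by rewrite Rminus_diag Rabs_R0; apply: blowup_error_ge0 => //; lra.
  - by case: fx; have := pos_INR w; lra.
  - by case: fW; have := pos_INR W; lra.
apply: (rho_blowup q r n N m w W) => //.
- by rewrite mulnC leq_divM.
- by apply: blowup_error_ge0 => //; lra.
- by apply: blowup_density => //; rewrite w0.
Qed.

(** * Vanishing of the error and the final sequence *)

Lemma le_div_small (a b e : R) :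
  (0 < e -> 0 <= a -> a / e <= b -> 0 < b -> a / b <= e)%R.
Proof.
move=> e0 a0 h b0; apply: (Rmult_le_reg_r b) => //.
have -> : (a / b * b = a)%R by field; lra.
have : (a / e * e <= b * e)%R by apply: Rmult_le_compat_r; lra.
by have -> : (a / e * e = a)%R; [field; lra | lra].
Qed.

(** The three terms vanish separately: the first because [d = 1 / (j + 1)], the second because
    [w / n <= g n / n], the third because [g] diverges and hence so does [w]. *)
Lemma blowup_error_small (g : nat -> R) (s : nat -> nat) (k : nat) (eps : R) :
  scaling_function g ->
  (forall M : nat, exists J : nat, forall j : nat, J <= j -> M <= s j) ->
  (0 < eps)%R ->
  exists J : nat, forall (j w : nat), J <= j -> is_floor (g (s j)) w ->
    0 < w /\ (blowup_error (/ INR j.+1) (s j) w k < eps)%R.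
Proof.
move=> [g_pos [g_inf g_small]] s_inf eps0.
(* Three terms of size at most [eps / 4] leave the strict inequality. *)
pose e := (eps / 4)%R; have e0 : (0 < e)%R by rewrite /e; lra.
have K0 := pos_INR k.
have KK0 : (0 <= INR k * INR k)%R by exact: Rmult_le_pos.
have [J0 hJ0] := INR_archimed 1 (INR k / e) Rlt_0_1.
(* Rounding down loses less than 1, which leaves [w > k^2 / e + 1] and in particular [w > 0]. *)
have [N1 hN1] := g_inf (INR k * INR k / e + 2)%R.
have [N2 hN2] := g_small e e0.
have [J1 hJ1] := s_inf (N1 + N2).+1.
exists (J0 + J1) => j w leJ [fw1 fw2].
have {}hJ1 : (N1 + N2).+1 <= s j by apply: hJ1; lia.
have hk : (0 <= INR k * INR k / e)%R by exact: Rle_mult_inv_pos.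
have Rw : (INR k * INR k / e + 1 < INR w)%R.
  have := hN1 (s j); have -> : N1 <= s j by lia.
  by move=> /(_ isT); lra.
have n0 : (0 < INR (s j))%R by apply: (INR_ltn 0); lia.
split.
  have : (INR 0 < INR w)%R by rewrite /=; lra.
  by move/INR_lt; lia.
have e1 : (/ INR j.+1 * INR k <= e)%R.
  rewrite Rmult_comm; apply: le_div_small => //; last by apply: (INR_ltn 0).
  have := INR_leq J0 j.+1; have -> : J0 <= j.+1 by lia.
  by move=> /(_ isT); lra.
have e2 : (INR w / INR (s j) <= e)%R.
  have /hN2 : (s j >= N2)%coq_nat by lia.
  rewrite /Rdist Rminus_0_r => /Rabs_def2[h _].
  apply: Rle_trans (Rlt_le _ _ h); apply: Rmult_le_compat_r => //.
  by apply: Rlt_le; exact: Rinv_0_lt_compat.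
have e3 : (INR k * INR k / INR w <= e)%R by apply: le_div_small => //; lra.
by rewrite /blowup_error; move: e1 e2 e3; rewrite /e; lra.
Qed.

Theorem mainTheorem5 (Xi : forall k : nat, 'S_k -> R) (f : nat -> R) :
  scale_limit Xi -> scaling_function f ->
  exists s : nat -> perm_any, converges_at_scale f s Xi.
Proof.
move=> [_ [g [sg [s [s_inf s_cv]]]]] sf.
(* The claim is made for every [j] so that choice yields a whole sequence. If the [j]-th permutation
   is empty or its window has floor 0, the bound is vacuous and the identity of size [j] serves;
   this happens only for finitely many [j]. The bound [j <= psize t] makes the sizes diverge. *)
have approx (j : nat) : exists t : perm_any, j <= psize t /\
    forall w, 0 < w -> 0 < psize (s j) -> is_floor (g (psize (s j))) w ->
    forall (k : nat) (pi : 'S_k),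
      (Rabs (rho pi (projT2 t) (f (psize t))
             - rho pi (projT2 (s j)) (g (psize (s j)))) <=
         blowup_error (/ INR j.+1) (psize (s j)) w k)%R.
  have [n0|n0] := posnP (psize (s j)).
    by exists (existT _ j (1%g : 'S_j)); split=> // w _; rewrite n0.
  have [gn0 gn] := sg.1 _ n0.
  have [w fw] := is_floor_exists _ (Rlt_le _ _ gn0).
  have [w0|w0] := posnP w.
    exists (existT _ j (1%g : 'S_j)); split=> // w' w'0 _ /is_floor_uniq/(_ fw).
    by move=> e; move: w'0; rewrite e w0.
  have wn : w <= psize (s j).
    suff : (INR w <= INR (psize (s j)))%R by move/INR_le; lia.
    by case: fw; lra.
  have jd : (0 < / INR j.+1 <= 1)%R.
    have j1 : (1 <= INR j.+1)%R by rewrite S_INR; have := pos_INR j; lra.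
    split; first by apply: Rinv_0_lt_compat; lra.
    by rewrite -Rinv_1; apply: Rinv_le_contravar; lra.
  have [|t [jt ht]] := rescale f _ w j (projT2 (s j)) _ _ sf _ fw jd.
    by rewrite w0.
  by exists t; split=> // w' _ _ /is_floor_uniq/(_ fw) ->.
have [t ht] := functional_choice _ approx.
exists t; split=> [M | k pi eps eps0].
  by exists M => j Mj; apply: leq_trans Mj (ht j).1.
have eps2 : (eps / 2 > 0)%R by lra.
have [J1 hJ1] := s_cv k pi _ eps2.
have [J2 hJ2] := blowup_error_small g (fun j => psize (s j)) k _ sg s_inf eps2.
have [J3 hJ3] := s_inf 1.
exists (J1 + J2 + J3) => j leJ.
have n0 : 0 < psize (s j) by apply: hJ3; lia.
have [w fw] := is_floor_exists _ (Rlt_le _ _ (sg.1 _ n0).1).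
have [w0 err] : 0 < w /\ _ := hJ2 j w ltac:(lia) fw.
have := (ht j).2 w w0 n0 fw k pi.
have /hJ1 : (j >= J1)%coq_nat by lia.
rewrite /Rdist => h1 h2.
set a := rho _ _ _ in h2 *; set b := rho _ _ _ in h1 h2 *.
(* One half of [eps] goes to the rescaling error, the other to the given convergence at scale
   [g]. *)
have -> : (a - Xi k pi = (a - b) + (b - Xi k pi))%R by ring.
by apply: Rle_lt_trans (Rabs_triang _ _) _; lra.
Qed.
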